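(* Let $X$ be a non-empty, at most countable set, let $I_X$ be the set of finitely supported functions $X\to\mathbb{Z}_{\ge 0}$, let $\mathcal{N}:I_X\to\mathbb{Z}_{>0}$ be a norm function as in the context, and let $C_K(M)$ denote the associated generalized Ramanujan sums. Suppose that $[x]=cx+O(x^{\alpha})$ for some $c>0$ and some $\alpha\in[0,1)$. (1) For each fixed $K\in I_X$, as $x\to\infty$, $$\sum_{M\in I_X,\ \mathcal{N}(M)\le x}C_K(M)=\begin{cases}cx+O(x^{\alpha}) & \text{if } K=0,\\ O(x^{\alpha}) & \text{otherwise,}\end{cases}$$ where the implied constants may depend on $K$. (2) Put $$S(x,y)=\sum_{\substack{M,K\in I_X\\ \mathcal{N}(M)\le x,\ \mathcal{N}(K)\le y}}C_K(M).$$ For any $\lambda>\frac{2-\alpha}{1-\alpha}$, under the condition $y^{\lambda}\ll x$ with $y\ge 1$, one has, as $x\to\infty$, $$S(x,y)=cx+o(x).$$ That is: for every $\lambda>\frac{2-\alpha}{1-\alpha}$, every constant $B>0$ and every $\varepsilon>0$ there is $x_0$ such that $|S(x,y)-cx|\le\varepsilon x$ for all real $x\ge x_0$ and all real $y\ge 1$ with $y^{\lambda}\le Bx$.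
   Context: Let $X$ be a non-empty set and let $F_X$ be the set of all maps $A:X\to\mathbb{Z}$ such that $A(x)\ne 0$ for only finitely many $x\in X$; it is an abelian group under pointwise addition, with zero element $0$. For $A,B\in F_X$ write $A\le B$ if $A(x)\le B(x)$ for every $x\in X$. Let $I_X=\{A\in F_X: A\ge 0\}$. Fix a function $\mathcal{N}:I_X\to\mathbb{Z}_{>0}$ such that $\mathcal{N}(0)=1$, $\mathcal{N}(A)>1$ if $A\ne 0$, and $\mathcal{N}(A+B)=\mathcal{N}(A)\mathcal{N}(B)$ for all $A,B\in I_X$. The Möbius function $\mu$ on $I_X$ is defined by $\mu(A)=(-1)^{\sum_{x\in X}A(x)}$ if $A(X)\subset\{0,1\}$, and $\mu(A)=0$ otherwise. For $M,K\in I_X$, the generalized Ramanujan sum is $$C_K(M)=\sum_{D\in I_X,\ D\le M,\ D\le K}\mathcal{N}(D)\,\mu(K-D).$$ When $X$ is at most countable, for real $x>0$ put $[x]=\#\{A\in I_X:\mathcal{N}(A)\le x\}$ (this is not the integer part). The hypothesis $[x]=cx+O(x^\alpha)$ refers to $x\to\infty$ and includes that $[x]$ is finite for every $x>0$. *)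

(* Defs.v *)
From mathcomp Require Import all_boot all_order all_algebra.
From mathcomp Require Export finmap multiset.
From mathcomp Require Import all_classical all_reals all_analysis.
Import Order.TTheory GRing.Theory Num.Theory.
Import numFieldNormedType.Exports.

Set Implicit Arguments.
Unset Strict Implicit.
Unset Printing Implicit Defensive.

Local Open Scope classical_set_scope.
Local Open Scope ring_scope.
Local Open Scope mset_scope.

(* Lets the Landau notation f = g +O_ F h be used with F := +oo%R. *)
Canonical pinfty_nbhs_filter_on (R : numFieldType) :=
  FilterType (pinfty_nbhs R) _.

(* I_X is {mset X}, the finitely supported functions X -> nat: its pointwise
   sum is `+`, its pointwise order is `<=`, and its zero is mset0. *)

(* Positivity of N follows from the first two conditions. *)
Definition norm_function (X : choiceType) (N : {mset X} -> nat) : Prop :=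
  [/\ N mset0 = 1%N,
      forall A : {mset X}, A <> mset0 -> (1 < N A)%N &
      forall A B : {mset X}, N (A `+` B) = (N A * N B)%N].

Definition mobius (X : choiceType) (A : {mset X}) : int :=
  if `[< forall x : X, A x = 0%N \/ A x = 1%N >]
  then (-1) ^+ (\sum_(x <- finsupp A) A x)%N
  else 0.

(* The set of indices is finite, so the finitely supported sum is the actual
   one. As D <= K, the truncated difference K `\` D is the true K - D. *)
Definition ramanujan_sum (X : choiceType) (N : {mset X} -> nat)
    (K M : {mset X}) : int :=
  \sum_(D \in [set D : {mset X} | D `<=` M /\ D `<=` K])
    (N D)%:Z * mobius (K `\` D)%mset.

Definition norm_le (R : realType) (X : choiceType) (N : {mset X} -> nat)
    (x : R) : set {mset X} := [set A | (N A)%:R <= x].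

(* Meaningful only if norm_le N x is finite: fset_set is empty otherwise. *)
Definition norm_count (R : realType) (X : choiceType) (N : {mset X} -> nat)
    (x : R) : nat := #|` fset_set (norm_le N x)|.

(* The finitely supported sums below are the actual ones when the sets
   norm_le N _ involved are finite. *)
Definition ramanujan_sum1 (R : realType) (X : choiceType)
    (N : {mset X} -> nat) (K : {mset X}) (x : R) : R :=
  \sum_(M \in norm_le N x) ((ramanujan_sum N K M)%:~R : R).

Definition ramanujan_sum2 (R : realType) (X : choiceType)
    (N : {mset X} -> nat) (x y : R) : R :=
  \sum_(MK \in (norm_le N x `*` norm_le N y)%classic)
    ((ramanujan_sum N MK.2 MK.1)%:~R : R).

(* Main.v *)
Require Import Defs.
From mathcomp Require Import all_boot all_order all_algebra.
From mathcomp Require Import all_classical all_reals all_analysis.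
From mathcomp Require Import zify ring lra.
Import Order.TTheory GRing.Theory Num.Theory.
Import numFieldNormedType.Exports.
Local Open Scope classical_set_scope.
Local Open Scope ring_scope.
Local Open Scope mset_scope.

(** Interchanging the sums over M and D writes the sum of C_K(M) over
    N(M) <= x as

      sum over D <= K of N(D) mu(K - D) [x / N(D)],

    because the M >= D with N(M) <= x are the D + E with N(E) <= x / N(D)
    ([ramanujan_sum1E]).  Replacing [x / N(D)] by c x / N(D) cancels the factor
    N(D), so the main term is c x times the sum of mu(K - D) over D <= K, which
    is 1 if K = 0 and 0 otherwise ([sum_mobius_below]).  This leaves an error
    of at most

      C x^alpha times the sum over D <= K of N(D)^(1 - alpha)

    ([ramanujan_sum1_bound]), where C is a constant with
    |[t] - c t| <= C t^alpha for every t > 0 and not only for large t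
    ([norm_count_uniform]); bounds for small t matter because the quotients
    y / N(D) below go down to 1.  For K fixed this is the first part of the
    theorem.

    For the second part these errors are summed over N(K) <= y.  Summing first
    over the K above a given D gives the factor [y / N(D)] = O(y / N(D)), and
    what remains, the sum of N(D)^(-alpha) over N(D) <= y, is O(y^(1 - alpha))
    ([sum_norm_power_bound]).  Only K = 0 contributes a main term, hence
    S(x, y) = c x + O(x^alpha y^(2 - alpha)), uniformly in x > 0 and y >= 1
    ([ramanujan_sum2_bound]).  If y^lambda <= B x, the error is
    O(x^(alpha + (2 - alpha) / lambda)), and this exponent is smaller than 1
    exactly when lambda > (2 - alpha) / (1 - alpha) ([power_saving]). *)

Set Implicit Arguments.
Unset Strict Implicit.
Unset Printing Implicit Defensive.

(** * Finitely supported sums *)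

Lemma fsumr_intr (R : pzRingType) (T : choiceType) (P : set T) (F : T -> int) :
  finite_set P ->
  ((\sum_(t \in P) F t)%:~R : R) = \sum_(t \in P) ((F t)%:~R : R).
Proof. by move=> fin; rewrite !fsbig_finite //= rmorph_sum. Qed.

Lemma fsumrD (V : zmodType) (T : choiceType) (P : set T) (F G : T -> V) :
  finite_set P ->
  \sum_(t \in P) (F t + G t) = \sum_(t \in P) F t + \sum_(t \in P) G t.
Proof. by move=> fin; rewrite !fsbig_finite //= big_split. Qed.

Lemma fsumrB (V : zmodType) (T : choiceType) (P : set T) (F G : T -> V) :
  finite_set P ->
  \sum_(t \in P) (F t - G t) = \sum_(t \in P) F t - \sum_(t \in P) G t.
Proof. by move=> fin; rewrite !fsbig_finite //= sumrB. Qed.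

Lemma ler_fsum (R : numDomainType) (T : choiceType) (P : set T)
    (F G : T -> R) : finite_set P -> (forall t, P t -> F t <= G t) ->
  \sum_(t \in P) F t <= \sum_(t \in P) G t.
Proof.
move=> fin FG; rewrite !fsbig_finite //= big_seq [leRHS]big_seq.
by apply: ler_sum => t; rewrite in_fset_set // inE => /FG.
Qed.

Lemma ler_norm_fsum (R : numDomainType) (T : choiceType) (P : set T)
    (F : T -> R) : finite_set P ->
  `|\sum_(t \in P) F t| <= \sum_(t \in P) `|F t|.
Proof. by move=> fin; rewrite !fsbig_finite //=; exact: ler_norm_sum. Qed.

(** * Submultisets and the Moebius function *)

Definition below (X : choiceType) (K : {mset X}) : set {mset X} :=
  [set D | D `<=` K].

(** Induction on the elements of K: a submultiset of a + K' either avoids a, and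
    is then one of K', or is a + D with D <= K'. *)
Lemma finite_below (X : choiceType) (K : {mset X}) : finite_set (below K).
Proof.
rewrite -[K]seq_mset_id; elim: (K : seq X) => [|a s IHs].
  apply: (@sub_finite_set _ _ [set mset0]); last exact: finite_set1.
  move=> D /msubsetP D0; apply/msetP => b.
  by have := D0 b; rewrite mset_seqE mset0E leqn0 => /eqP.
apply: (@sub_finite_set _ _
    ((below (seq_mset s) `|` msetD [mset a] @` below (seq_mset s))%classic)).
  move=> D /msubsetP Das; have [aD|aND] := boolP (a \in D).
    right; exists (D `\ a); last exact: msetB1K.
    apply/msubsetP => b; have := Das b.
    by rewrite msetB1E !mset_seqE /= [b == a]eq_sym leq_subLR.
  left; apply/msubsetP => b; have := Das b; rewrite !mset_seqE /=.
  by have [<-|] := eqVneq a b; rewrite ?(mset_eq0P aND).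
by rewrite finite_setU; split=> //; exact: finite_image.
Qed.

Lemma sum_below_rev (V : nmodType) (X : choiceType) (K : {mset X})
    (F : {mset X} -> V) :
  \sum_(D \in below K) F (K `\` D) = \sum_(D \in below K) F D.
Proof.
have leB D : (K `\` D) `<=` K.
  by apply/msubsetP => a; rewrite msetE2 leq_subr.
have invB D : D `<=` K -> K `\` (K `\` D) = D.
  by move=> /msubsetP DK; apply/msetP => a; rewrite !msetE2 subKn.
rewrite [RHS](reindex_fsbig (fun D => K `\` D) (below K)) //; split.
- by move=> D _; exact: leB.
- move=> D E; rewrite !inE => DK EK KDE.
  by rewrite -(invB D DK) KDE invB.
- by move=> D DK; exists (K `\` D); [exact: leB|exact: invB].
Qed.

Lemma mobius0 (X : choiceType) : mobius (mset0 : {mset X}) = 1.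
Proof.
rewrite /mobius asboolT; last by move=> a; left; rewrite mset0E.
by rewrite finsupp0 big_nil.
Qed.

Lemma mobius_msetD1 (X : choiceType) (a : X) (D : {mset X}) :
  D a = 0%N -> mobius (a +` D) = - mobius D.
Proof.
move=> Da; rewrite /mobius.
have -> : (forall b, (a +` D) b = 0%N \/ (a +` D) b = 1%N) =
          (forall b, D b = 0%N \/ D b = 1%N).
  rewrite propeqE; split=> H b; have := H b; rewrite mset1DE.
    by have [->|_] := eqVneq b a; rewrite ?Da; [left|].
  by have [->|_] := eqVneq b a; rewrite ?Da; [right|].
case: asboolP => // _.
have -> : finsupp (a +` D) = (a |` finsupp D)%fset.
  apply/fsetP => b; rewrite in_fsetU in_fset1 !mem_finsupp mset1DE.
  by case: (b == a).
rewrite big_fsetU1 ?mem_finsupp ?Da //= mset1DE eqxx Da exprD expr1 mulN1r.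
congr (- (-1) ^+ _); apply: eq_big_seq => b; rewrite mem_finsupp mset1DE.
by have [->|_] := eqVneq b a; rewrite ?Da.
Qed.

(** The involution behind the cancellation in Moebius sums.  The third case is
    harmless because mu vanishes there. *)
Definition toggle (X : choiceType) (a : X) (D : {mset X}) : {mset X} :=
  if D a == 0%N then a +` D else if D a == 1%N then D `\ a else D.

Lemma toggleK (X : choiceType) (a : X) : involutive (toggle a).
Proof.
move=> D; rewrite /toggle; case: (eqVneq (D a) 0%N) => [Da|D0].
  by rewrite mset1DE eqxx Da msetD1K.
case: (eqVneq (D a) 1%N) => [Da|D1]; last by rewrite (negbTE D0) (negbTE D1).
by rewrite msetB1E eqxx Da /= msetB1K // -mset_neq0.
Qed.

Lemma mobius_toggle (X : choiceType) (a : X) (D : {mset X}) :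
  mobius (toggle a D) = - mobius D.
Proof.
rewrite /toggle; have [Da|D0] := eqVneq (D a) 0%N; first exact: mobius_msetD1.
have [Da|D1] := eqVneq (D a) 1%N.
  rewrite -[in RHS](@msetB1K _ a D) -?mset_neq0 //.
  by rewrite mobius_msetD1 ?opprK // msetB1E eqxx Da.
rewrite /mobius asboolF ?oppr0 // => /(_ a)[] Da.
  by rewrite Da in D0.
by rewrite Da in D1.
Qed.

Lemma toggle_below (X : choiceType) (a : X) (K D : {mset X}) :
  a \in K -> D `<=` K -> toggle a D `<=` K.
Proof.
rewrite -mset_gt0 => Ka /msubsetP DK; rewrite /toggle.
have [Da|D0] := eqVneq (D a) 0%N; last have [Da|D1] := eqVneq (D a) 1%N;
  last exact/msubsetP.
- apply/msubsetP => b; rewrite mset1DE.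
  by have [->|_] := eqVneq b a; rewrite ?Da ?addn0 // add0n.
- apply/msubsetP => b; rewrite msetB1E.
  exact: leq_trans (leq_subr _ _) (DK b).
Qed.

(** If K contains a, toggling a permutes the submultisets of K and changes the
    sign of mu, so the sum equals its own opposite. *)
Lemma sum_mobius_below (X : choiceType) (K : {mset X}) :
  \sum_(D \in below K) mobius D = (K == mset0)%:R.
Proof.
have [->|K0] := eqVneq K mset0.
  have -> : below mset0 = [set mset0 : {mset X}].
    apply/seteqP; split=> D /=; last by move=> ->; exact: msubset_refl.
    move=> /msubsetP D0; apply/msetP => b.
    by have := D0 b; rewrite mset0E leqn0 => /eqP.
  by rewrite fsbig_set1 mobius0.
have [a aK] : exists a, a \in K.
  apply: contrapT => /forallNP Kempty; case/eqP: K0; apply/msetP => a.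
  by rewrite mset0E; apply/mset_eq0P/negP/Kempty.
set S := LHS; suff : S = - S by lia.
rewrite /S [LHS](reindex_fsbig (toggle a) (below K)); last first.
  split.
  - by move=> D /= DK; exact: toggle_below.
  - by move=> D E _ _; exact: (inv_inj (toggleK a)).
  - by move=> D DK; exists (toggle a D); rewrite ?toggleK //; exact: toggle_below.
rewrite -mulN1r mulr_fsumr.
by apply: eq_fsbigr => D _; rewrite mobius_toggle mulN1r.
Qed.

Lemma normr_mobius_le1 (X : choiceType) (D : {mset X}) : `|mobius D| <= 1.
Proof.
rewrite /mobius; case: ifP => _; last by rewrite normr0.
by rewrite normrX normrN1 expr1n.
Qed.

(** * Counting by norm *)

Lemma norm_gt0 (X : choiceType) (N : {mset X} -> nat) (A : {mset X}) :
  norm_function N -> (0 < N A)%N.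
Proof.
move=> [N0 N1 _]; have [->|/eqP A0] := eqVneq A mset0; first by rewrite N0.
exact: ltn_trans (N1 A A0).
Qed.

Lemma norm_le_monotone (X : choiceType) (N : {mset X} -> nat)
    (D K : {mset X}) :
  norm_function N -> D `<=` K -> (N D <= N K)%N.
Proof.
move=> Nn DK; have [_ _ NM] := Nn.
have -> : K = D `+` (K `\` D).
  by apply/msetP => a; rewrite !msetE2 subnKC //; exact: (msubsetP DK).
by rewrite NM leq_pmulr // norm_gt0.
Qed.

Lemma norm_le_lt1 (R : realType) (X : choiceType) (N : {mset X} -> nat)
    (x : R) : norm_function N -> x < 1 -> norm_le N x = set0.
Proof.
move=> Nn x1; rewrite -subset0 => A /= NAx.
have := le_lt_trans NAx x1; rewrite ltrn1 => NA0.
by have := norm_gt0 A Nn; rewrite ltnNge -ltnS NA0.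
Qed.

Lemma sum1_norm_le (R : realType) (X : choiceType) (N : {mset X} -> nat)
    (x : R) : finite_set (norm_le N x) ->
  \sum_(A \in norm_le N x) (1 : R) = (norm_count N x)%:R.
Proof.
by move=> fin; rewrite fsbig_finite //= /norm_count -sum1_size natr_sum.
Qed.

(** The norm is multiplicative, so E |-> D + E is a bijection from the E with
    N(E) <= x / N(D) onto the M >= D with N(M) <= x. *)
Lemma sum_multiples (R : realType) (X : choiceType) (N : {mset X} -> nat)
    (D : {mset X}) (x : R) : norm_function N ->
  finite_set (norm_le N (x / (N D)%:R)) ->
  \sum_(M \in norm_le N x) (if D `<=` M then 1 else 0 : R) =
  (norm_count N (x / (N D)%:R))%:R.
Proof.
move=> Nn fin; have [_ _ NM] := Nn.
have ND0 : 0 < (N D)%:R :> R by rewrite ltr0n norm_gt0.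
rewrite -sum1_norm_le //.
have -> : \sum_(M \in norm_le N x) (if D `<=` M then 1 else 0 : R) =
    \sum_(M \in (norm_le N x `&`
      [set M : {mset X} | (D `<=` M)%mset])%classic) (1 : R).
  by rewrite fsbig_mkcondr; apply: eq_fsbigr => M _; rewrite mem_setE.
rewrite (reindex_fsbig (msetD D) (norm_le N (x / (N D)%:R))) //; split.
- move=> E /=; rewrite /norm_le /= ler_pdivlMr // NM natrM mulrC => ?; split=> //.
  by apply/msubsetP => a; rewrite msetE2 leq_addr.
- by move=> E F _ _; exact: (can_inj (@msetDKB _ D)).
- move=> M [/= NMx /msubsetP DM].
  have MD : D `+` (M `\` D) = M.
    by apply/msetP => a; rewrite !msetE2 subnKC.
  exists (M `\` D) => //.
  by rewrite /norm_le /= ler_pdivlMr // mulrC -natrM -NM MD.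
Qed.

Lemma ramanujan_sum1E (R : realType) (X : choiceType) (N : {mset X} -> nat)
    (K : {mset X}) (x : R) :
  norm_function N -> (forall z : R, finite_set (norm_le N z)) ->
  ramanujan_sum1 N K x =
  \sum_(D \in below K)
    ((N D)%:R * (mobius (K `\` D))%:~R * (norm_count N (x / (N D)%:R))%:R : R).
Proof.
move=> Nn fin; rewrite /ramanujan_sum1.
transitivity (\sum_(M \in norm_le N x) \sum_(D \in below K)
    ((N D)%:R * (mobius (K `\` D))%:~R * (if D `<=` M then 1 else 0) : R)).
  apply: eq_fsbigr => M _; rewrite /ramanujan_sum.
  rewrite (fsbig_mkcondl _ [set D : {mset X} | (D `<=` M)%mset] (below K)).
  rewrite fsumr_intr; last exact: finite_below.
  apply: eq_fsbigr => D _; rewrite mem_setE -[_ \in _]/(D `<=` M).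
  case: ifP => _.
    by rewrite intrM mulr1.
  by rewrite mulr0.
rewrite exchange_fsbig //; last exact: finite_below.
by apply: eq_fsbigr => D _; rewrite -mulr_fsumr sum_multiples.
Qed.

Lemma ramanujan_sum2E (R : realType) (X : choiceType) (N : {mset X} -> nat)
    (x y : R) : (forall z : R, finite_set (norm_le N z)) ->
  ramanujan_sum2 N x y = \sum_(K \in norm_le N y) ramanujan_sum1 N K x.
Proof.
by move=> fin; rewrite /ramanujan_sum1 exchange_fsbig // pair_fsbig.
Qed.

(** K >= D forces N(D) <= N(K) <= y, so after the exchange D runs over the whole
    set N(D) <= y, and the K above a given D are counted by [sum_multiples]. *)
Lemma sum_below_exchange (R : realType) (X : choiceType)
    (N : {mset X} -> nat) (y : R) (g : {mset X} -> R) :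
  norm_function N -> (forall z : R, finite_set (norm_le N z)) ->
  \sum_(K \in norm_le N y) \sum_(D \in below K) g D =
  \sum_(D \in norm_le N y) g D * (norm_count N (y / (N D)%:R))%:R.
Proof.
move=> Nn fin.
transitivity (\sum_(K \in norm_le N y) \sum_(D \in norm_le N y)
    g D * (if D `<=` K then 1 else 0 : R)).
  apply: eq_fsbigr => K; rewrite inE => Ky.
  have -> : below K = (norm_le N y `&` below K)%classic.
    apply/seteqP; split=> D /= => [DK|[]//]; split=> //.
    by apply: le_trans Ky; rewrite ler_nat norm_le_monotone.
  rewrite fsbig_mkcondr; apply: eq_fsbigr => D _.
  rewrite mem_setE -[_ \in _]/(D `<=` K).
  by case: ifP => _; rewrite ?mulr1 ?mulr0.
rewrite exchange_fsbig //.
by apply: eq_fsbigr => D _; rewrite -mulr_fsumr sum_multiples.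
Qed.

(** * Estimates *)

Lemma leq_norm_count (R : realType) (X : choiceType) (N : {mset X} -> nat)
    (s t : R) : finite_set (norm_le N t) -> s <= t ->
  (norm_count N s <= norm_count N t)%N.
Proof.
move=> fint st; have sub : (norm_le N s `<=` norm_le N t)%classic.
  by move=> A /= As; exact: le_trans As st.
have fins : finite_set (norm_le N s) by exact: sub_finite_set sub fint.
apply: fsubset_leq_card; apply/fsubsetP => A.
by rewrite !in_fset_set // !inE => /sub.
Qed.

(** The asymptotic hypothesis gives the bound beyond some T1 >= 1.  On [1, T1]
    the left side is bounded and t^alpha >= 1; below 1 nothing is counted, and
    c t <= c t^alpha since alpha <= 1. *)
Lemma norm_count_uniform (R : realType) (X : choiceType)
    (N : {mset X} -> nat) (c alpha : R) :
  norm_function N -> (forall z : R, finite_set (norm_le N z)) ->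
  0 <= c -> 0 <= alpha -> alpha <= 1 ->
  (fun x : R => (norm_count N x)%:R : R)
    = (fun x : R => c * x) +O_ (+oo%R) (fun x : R => x `^ alpha) ->
  exists2 C : R, 0 < C &
    forall t, 0 < t -> `|(norm_count N t)%:R - c * t| <= C * t `^ alpha.
Proof.
move=> Nn fin c0 a0 a1 /eqaddOP /pinfty_ex_gt0[k k0 [T [_ asymp]]].
pose T1 := Num.max T 1; have T1_ge1 : 1 <= T1 by rewrite le_max lexx orbT.
have cT0 : 0 <= c * T1 by rewrite mulr_ge0 // (le_trans ler01).
have nT0 : 0 <= (norm_count N T1)%:R :> R by [].
exists (k + (norm_count N T1)%:R + c * T1) => [|t t0].
  by rewrite ltr_wpDr // ltr_wpDr.
have [Tt|tT] := ltP T1 t.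
  have Tt' : T < t by apply: le_lt_trans Tt; rewrite le_max lexx.
  apply: le_trans (asymp t Tt') _; rewrite ger0_norm ?powR_ge0 //.
  by rewrite ler_wpM2r ?powR_ge0 // -addrA lerDl addr_ge0.
have [t1|t1] := ltP t 1.
  have -> : norm_count N t = 0%N.
    by rewrite /norm_count norm_le_lt1 // fset_set0 cardfs0.
  rewrite sub0r normrN ger0_norm ?mulr_ge0 ?(ltW t0) //.
  apply: (@le_trans _ _ (c * t `^ alpha)).
    by rewrite ler_wpM2l // ger1_powR // t0 ltW.
  rewrite ler_wpM2r ?powR_ge0 //.
  have : c <= c * T1 by rewrite ler_peMr.
  lra.
apply: (@le_trans _ _ ((norm_count N T1)%:R + c * T1)).
  apply: (le_trans (ler_normB _ _)); apply: lerD.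
    by rewrite normr_nat ler_nat leq_norm_count.
  by rewrite ger0_norm ?mulr_ge0 ?(ltW t0) // ler_wpM2l.
apply: (@le_trans _ _ (k + (norm_count N T1)%:R + c * T1)).
  by rewrite -addrA lerDr ltW.
rewrite ler_peMr //; first by rewrite addr_ge0 ?addr_ge0 // ltW.
by rewrite -(powRr0 t) ler_powR.
Qed.

Lemma norm_count_linear (R : realType) (X : choiceType)
    (N : {mset X} -> nat) (c C alpha : R) :
  norm_function N -> 0 <= c -> 0 <= C -> alpha <= 1 ->
  (forall t, 0 < t -> `|(norm_count N t)%:R - c * t| <= C * t `^ alpha) ->
  forall t : R, 0 < t -> (norm_count N t)%:R <= (c + C) * t.
Proof.
move=> Nn c0 C0 a1 bound t t0; have [t1|t1] := ltP t 1.
  rewrite /norm_count norm_le_lt1 // fset_set0 cardfs0.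
  by rewrite mulr_ge0 ?addr_ge0 // ltW.
have tat : C * t `^ alpha <= C * t by rewrite ler_wpM2l // ler1_powR.
have := bound t t0; rewrite ler_norml => /andP[_].
by rewrite mulrDl; lra.
Qed.

Lemma ramanujan_sum1_bound (R : realType) (X : choiceType)
    (N : {mset X} -> nat) (c C alpha : R) (K : {mset X}) (x : R) :
  norm_function N -> (forall z : R, finite_set (norm_le N z)) ->
  (forall t, 0 < t -> `|(norm_count N t)%:R - c * t| <= C * t `^ alpha) ->
  0 < x ->
  `|ramanujan_sum1 N K x - c * x * (K == mset0)%:R| <=
    C * x `^ alpha * \sum_(D \in below K) (N D)%:R `^ (1 - alpha).
Proof.
move=> Nn fin bound x0; have finK := finite_below K.
(* The main term as the sum of ramanujan_sum1E with c t in place of [t]. *)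
have -> : c * x * (K == mset0)%:R = \sum_(D \in below K)
    ((N D)%:R * (mobius (K `\` D))%:~R * (c * (x / (N D)%:R)) : R).
  have -> : (K == mset0)%:R = (\sum_(D \in below K) mobius D)%:~R :> R.
    by rewrite sum_mobius_below; case: (K == mset0).
  rewrite -sum_below_rev fsumr_intr // mulr_fsumr.
  apply: eq_fsbigr => D _; have ND0 : (N D)%:R != 0 :> R.
    by rewrite pnatr_eq0 -lt0n norm_gt0.
  by field.
rewrite ramanujan_sum1E // mulr_fsumr -fsumrB //.
apply: le_trans (ler_norm_fsum _ finK) _; apply: ler_fsum => // D _.
have ND0 : 0 < (N D)%:R :> R by rewrite ltr0n norm_gt0.
rewrite -mulrBr !normrM normr_nat -mulrA.
have -> : C * x `^ alpha * (N D)%:R `^ (1 - alpha) =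
    (N D)%:R * (1 * (C * (x / (N D)%:R) `^ alpha)).
  rewrite powRM ?invr_ge0 ?(ltW ND0) ?(ltW x0) //.
  rewrite -powR_inv1 ?(ltW ND0) // -powRrM mulN1r.
  rewrite powRD ?(gt_eqF ND0) ?implybT // powRr1 ?(ltW ND0) //.
  by ring.
apply: ler_wpM2l; first exact: ltW.
apply: ler_pM => //; last by apply: bound; exact: divr_gt0.
by rewrite -intr_norm -[1]/(1%:~R) ler_int normr_mobius_le1.
Qed.

(** Halving y: the terms with N(D) > y / 2 contribute at most
    L y (y / 2)^(-alpha), of the order y^(1 - alpha), and the other terms are
    the same sum at y / 2, where the bound is smaller by the factor
    r = 2^(alpha - 1) < 1. *)
Lemma sum_norm_power_bound (R : realType) (X : choiceType)
    (N : {mset X} -> nat) (L alpha : R) :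
  norm_function N -> (forall z : R, finite_set (norm_le N z)) ->
  0 < L -> 0 <= alpha -> alpha < 1 ->
  (forall t : R, 0 < t -> (norm_count N t)%:R <= L * t) ->
  exists2 A : R, 0 < A & forall y, 0 < y ->
    \sum_(D \in norm_le N y) (N D)%:R `^ (- alpha) <= A * y `^ (1 - alpha).
Proof.
move=> Nn fin L0 a0 a1 lin.
pose r : R := 2^-1 `^ (1 - alpha).
have r1 : r < 1.
  have -> : 1 = 1 `^ (1 - alpha) :> R by rewrite powR1.
  by rewrite gt0_ltr_powR ?nnegrE ?subr_gt0 ?invr_ge0 ?invf_lt1 ?ltr1n.
(* The fixed point of the recursion A = A r + L 2^alpha given by halving. *)
exists (L * 2 `^ alpha / (1 - r)) => [|y y0].
  by rewrite divr_gt0 ?mulr_gt0 ?powR_gt0 ?subr_gt0.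
set A := _ / _.
have Arec : A * r + L * 2 `^ alpha = A.
  rewrite /A; field; lra.
(* Halvings until y < 1, where the sum is empty. *)
have [n yn] : exists n : nat, y < 2 ^+ n.
  exists (Num.bound y); apply: lt_trans (archi_boundP (ltW y0)) _.
  by rewrite -natrX ltr_nat ltn_expl.
elim: n y y0 yn => [y y0|n IHn y y0 yn].
  rewrite expr0 => y1; rewrite norm_le_lt1 // fsbig_set0.
  by rewrite mulr_ge0 ?powR_ge0 // divr_ge0 ?mulr_ge0 ?powR_ge0 ?subr_ge0 ?ltW.
have y20 : 0 < y / 2 by rewrite divr_gt0.
have : y / 2 < 2 ^+ n by rewrite ltr_pdivrMr // -exprSr.
move=> /(IHn _ y20) IHy.
have yy2 : (norm_le N y `&` norm_le N (y / 2))%classic = norm_le N (y / 2).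
  apply/seteqP; split=> D /= => [[]//|Dy]; split=> //.
  by apply: le_trans Dy _; lra.
apply: (@le_trans _ _ (\sum_(D \in norm_le N y)
   ((if D \in norm_le N (y / 2) then (N D)%:R `^ (- alpha) else 0) +
    (y / 2) `^ (- alpha)))).
  apply: ler_fsum => // D Dy; case: ifPn => [_|].
    by rewrite lerDl powR_ge0.
  move/negP; rewrite inE /norm_le /= => /negP; rewrite -ltNge => yD.
  have ND0 := lt_trans y20 yD.
  rewrite add0r !powRN lef_pV2 ?posrE ?powR_gt0 //.
  by rewrite ge0_ler_powR ?nnegrE // ltW.
rewrite fsumrD // -fsbig_mkcondr yy2.
rewrite -[A in leRHS]Arec mulrDl; apply: lerD.
  apply: le_trans IHy _.
  by rewrite powRM ?invr_ge0 ?(ltW y0) // -/r [_ * r]mulrC mulrA lexx.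
rewrite -[(y / 2) `^ (- alpha)]mul1r -mulr_fsuml sum1_norm_le //.
apply: (@le_trans _ _ (L * y * (y / 2) `^ (- alpha))).
  by rewrite ler_wpM2r ?powR_ge0 // lin.
rewrite powRM ?invr_ge0 ?(ltW y0) // -powR_inv1 // -powRrM mulN1r opprK.
rewrite powRD ?(gt_eqF y0) ?implybT // powRr1 ?(ltW y0) //.
by rewrite le_eqVlt; apply/orP; left; apply/eqP; ring.
Qed.

Lemma ramanujan_sum2_bound (R : realType) (X : choiceType)
    (N : {mset X} -> nat) (c C alpha : R) :
  norm_function N -> (forall z : R, finite_set (norm_le N z)) ->
  0 <= c -> 0 < C -> 0 <= alpha -> alpha < 1 ->
  (forall t, 0 < t -> `|(norm_count N t)%:R - c * t| <= C * t `^ alpha) ->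
  exists2 C' : R, 0 < C' & forall x y, 0 < x -> 1 <= y ->
    `|ramanujan_sum2 N x y - c * x| <= C' * x `^ alpha * y `^ (2 - alpha).
Proof.
move=> Nn fin c0 C0 a0 a1 bound.
have lin := norm_count_linear Nn c0 (ltW C0) (ltW a1) bound.
have L0 : 0 < c + C by exact: ltr_wpDl.
have [A A0 power] := sum_norm_power_bound Nn fin L0 a0 a1 lin.
exists (C * (c + C) * A) => [|x y x0 y1]; first by rewrite !mulr_gt0.
have y0 : 0 < y by exact: lt_le_trans y1.
(* Spreading the main term over all K lets each K be estimated separately. *)
have -> : c * x = \sum_(K \in norm_le N y) c * x * (K == mset0)%:R.
  rewrite (fsbigD1 mset0) //=; last by rewrite /norm_le /=; have [-> _ _] := Nn.
  by rewrite eqxx mulr1 fsbig1 ?addr0 // => K [_ /eqP/negbTE ->]; rewrite mulr0.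
rewrite ramanujan_sum2E // -fsumrB //.
apply: le_trans (ler_norm_fsum _ (fin y)) _.
apply: (@le_trans _ _ (\sum_(K \in norm_le N y) (C * x `^ alpha *
    \sum_(D \in below K) (N D)%:R `^ (1 - alpha)))).
  by apply: ler_fsum => // K _; exact: ramanujan_sum1_bound.
rewrite -mulr_fsumr sum_below_exchange //.
have -> : C * (c + C) * A * x `^ alpha * y `^ (2 - alpha) =
    C * x `^ alpha * ((c + C) * y * (A * y `^ (1 - alpha))).
  have -> : 2 - alpha = 1 + (1 - alpha) by ring.
  by rewrite powRD ?(gt_eqF y0) ?implybT // powRr1 ?(ltW y0) //; ring.
apply: ler_wpM2l; first by rewrite mulr_ge0 ?powR_ge0 // ltW.
apply: (@le_trans _ _ ((c + C) * y *
    \sum_(D \in norm_le N y) (N D)%:R `^ (- alpha))); last first.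
  by apply: ler_wpM2l; [rewrite mulr_ge0 // ltW|exact: power].
rewrite mulr_fsumr; apply: ler_fsum => // D _.
have ND0 : 0 < (N D)%:R :> R by rewrite ltr0n norm_gt0.
rewrite powRD ?(gt_eqF ND0) ?implybT // powRr1 ?(ltW ND0) //.
apply: (@le_trans _ _ ((N D)%:R * (N D)%:R `^ (- alpha) *
    ((c + C) * (y / (N D)%:R)))).
  apply: ler_wpM2l; first by rewrite mulr_ge0 ?powR_ge0.
  by apply: lin; rewrite divr_gt0.
rewrite le_eqVlt; apply/orP; left; apply/eqP; field.
by rewrite gt_eqF.
Qed.

(** With theta = beta / lambda, the hypothesis gives y^beta <= (B x)^theta, and
    the condition on lambda says that alpha + theta < 1; the threshold is where
    x^(1 - alpha - theta) absorbs the constants. *)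
Lemma power_saving (R : realType) (C alpha beta lambda B eps : R) :
  0 < C -> 0 <= beta -> alpha < 1 -> 0 < B -> 0 < eps ->
  beta / (1 - alpha) < lambda ->
  exists2 x0 : R, 0 < x0 & forall x y : R, x0 <= x -> 0 <= y ->
    y `^ lambda <= B * x -> C * x `^ alpha * y `^ beta <= eps * x.
Proof.
move=> C0 b0 a1 B0 e0 lam.
have a1' : 0 < 1 - alpha by rewrite subr_gt0.
have l0 : 0 < lambda by apply: le_lt_trans lam; rewrite divr_ge0 // ltW.
pose theta := beta / lambda; pose delta := 1 - alpha - theta.
have theta0 : 0 <= theta by rewrite divr_ge0 // ltW.
have delta0 : 0 < delta.
  by rewrite subr_gt0 ltr_pdivrMr // mulrC -ltr_pdivrMr.
pose Q := C * B `^ theta / eps.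
have Q0 : 0 < Q by rewrite divr_gt0 // mulr_gt0 ?powR_gt0.
exists (Q `^ delta^-1) => [|x y x0x y0 yx]; first by rewrite powR_gt0.
have x0 : 0 < x by apply: lt_le_trans x0x; rewrite powR_gt0.
have Qx : Q <= x `^ delta.
  rewrite -[Q]powRr1 ?(ltW Q0) // -(mulVf (lt0r_neq0 delta0)) powRrM.
  by rewrite ge0_ler_powR ?nnegrE ?powR_ge0 // ltW.
have ybound : y `^ beta <= B `^ theta * x `^ theta.
  have -> : beta = lambda * theta by rewrite mulrC divfK // gt_eqF.
  rewrite powRrM -powRM ?(ltW B0) ?(ltW x0) //.
  by rewrite ge0_ler_powR ?nnegrE ?powR_ge0 // mulr_ge0 // ltW.
apply: (@le_trans _ _ (C * x `^ alpha * (B `^ theta * x `^ theta))).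
  by rewrite ler_wpM2l // mulr_ge0 ?powR_ge0 // ltW.
have -> : C * x `^ alpha * (B `^ theta * x `^ theta) =
    eps * (Q * (x `^ alpha * x `^ theta)).
  by rewrite /Q; field; rewrite gt_eqF.
have -> : eps * x = eps * (x `^ delta * (x `^ alpha * x `^ theta)).
  rewrite -!powRD ?(gt_eqF x0) ?implybT //.
  have -> : delta + (alpha + theta) = 1 by rewrite /delta; ring.
  by rewrite powRr1 // ltW.
by rewrite ler_wpM2l ?ler_wpM2r ?mulr_ge0 ?powR_ge0 // ltW.
Qed.

Unset Implicit Arguments.

Theorem theorem2 (R : realType) (X : choiceType)
    (X_nonempty : [set: X] !=set0) (X_countable : countable [set: X])
    (N : {mset X} -> nat) (N_norm : norm_function N)
    (c alpha : R) (c_gt0 : 0 < c) (alpha_ge0 : 0 <= alpha) (alpha_lt1 : alpha < 1)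
    (count_finite : forall x : R, 0 < x -> finite_set (norm_le N x))
    (count_asymp : (fun x : R => (norm_count N x)%:R : R)
       = (fun x : R => c * x) +O_ (+oo%R) (fun x : R => x `^ alpha)) :
  (forall K : {mset X},
     (K = mset0 ->
        ramanujan_sum1 N K
        = (fun x : R => c * x) +O_ (+oo%R) (fun x : R => x `^ alpha)) /\
     (K <> mset0 ->
        (ramanujan_sum1 N K : R -> R) =O_ (+oo%R) (fun x : R => x `^ alpha))) /\
  (forall lambda : R, (2 - alpha) / (1 - alpha) < lambda ->
   forall B : R, 0 < B -> forall eps : R, 0 < eps ->
   exists x0 : R, forall x y : R, x0 <= x -> 1 <= y -> y `^ lambda <= B * x ->
     `|ramanujan_sum2 N x y - c * x| <= eps * x).
Proof.
have fin (z : R) : finite_set (norm_le N z).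
  have [z0|z0] := ltP 0 z; first exact: count_finite.
  by rewrite norm_le_lt1 // (le_lt_trans z0).
have [C C0 bound] :=
  norm_count_uniform N_norm fin (ltW c_gt0) alpha_ge0 (ltW alpha_lt1)
    count_asymp.
split=> [K|lambda lam B B0 eps eps0].
  pose S := \sum_(D \in below K) (N D)%:R `^ (1 - alpha).
  have sum1 x := ramanujan_sum1_bound K (x := x) N_norm fin bound.
  have nearO (f : R -> R) :
      (forall x, 0 < x -> `|f x| <= C * x `^ alpha * S) ->
      \forall k \near +oo, \forall x \near +oo,
        `|f x| <= k * `|x `^ alpha|.
    move=> fS; exists (C * S); split=> [|k Sk]; first exact: num_real.
    exists 0; split=> // x x0; apply: le_trans (fS x x0) _.
    by rewrite ger0_norm ?powR_ge0 // mulrAC ler_wpM2r ?powR_ge0 // ltW.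
  split=> [K0|/eqP K0].
    apply/eqaddOP/nearO => x x0; have := sum1 x x0.
    by rewrite {2}K0 eqxx mulr1.
  apply/eqOP/nearO => x x0; have := sum1 x x0.
  by rewrite (negbTE K0) mulr0 subr0.
have [C' C'0 sum2] :=
  ramanujan_sum2_bound N_norm fin (ltW c_gt0) C0 alpha_ge0 alpha_lt1 bound.
have beta0 : 0 <= 2 - alpha by lra.
have [x0 x0_gt0 saving] := power_saving C'0 beta0 alpha_lt1 B0 eps0 lam.
exists x0 => x y x0x y1 yx.
apply: le_trans (sum2 x y (lt_le_trans x0_gt0 x0x) y1) _.
by apply: saving => //; exact: le_trans y1.
Qed.
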